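(* Let $h(\boldsymbol{\theta},\mathbf{v})$ be the h-likelihood of a statistical model $f_{\boldsymbol{\theta}}(\mathbf{y},\mathbf{v})$ with fixed unknowns $\boldsymbol{\theta}$ and continuous random unknowns $\mathbf{v}$, let $\mathcal{I}_{\boldsymbol{\theta}}=\mathrm{E}\{-\nabla^2_{\boldsymbol{\theta},\mathbf{v}}h(\boldsymbol{\theta},\mathbf{v})\}$ be the expected h-information, let $\boldsymbol{\zeta}(\boldsymbol{\theta},\mathbf{v})$ be an arbitrary function of $(\boldsymbol{\theta},\mathbf{v})$, and let $\widehat{\boldsymbol{\zeta}}(\mathbf{y})$ be an unbiased estimator of it, in the sense that $$\mathrm{E}\left[\widehat{\boldsymbol{\zeta}}(\mathbf{y})-\boldsymbol{\zeta}(\boldsymbol{\theta},\mathbf{v})\right]=0 .$$ Let $\mathcal{Z}_{\boldsymbol{\theta}}=\mathrm{E}\left[\nabla_{\boldsymbol{\theta},\mathbf{v}}\boldsymbol{\zeta}(\boldsymbol{\theta},\mathbf{v})\right]$. Under regularity conditions (R1)--(R6) of the context, $$\mathrm{Var}\left[\widehat{\boldsymbol{\zeta}}(\mathbf{y})-\boldsymbol{\zeta}(\boldsymbol{\theta},\mathbf{v})\right]\ \geq\ \mathcal{Z}_{\boldsymbol{\theta}}\,\mathcal{I}_{\boldsymbol{\theta}}^{-1}\,\mathcal{Z}_{\boldsymbol{\theta}}^{\intercal},$$ where the matrix inequality $A\geq B$ means that $A-B$ is positive semi-definite.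
   Context: Model: $f_{\boldsymbol{\theta}}(\mathbf{y},\mathbf{v})=f_{\boldsymbol{\theta}}(\mathbf{y}|\mathbf{v})f_{\boldsymbol{\theta}}(\mathbf{v})$ is the joint density of observed data $\mathbf{y}\in\Omega_{\mathbf{y}}$ and continuous random unknowns $\mathbf{v}=(v_1,\dots,v_n)^{\intercal}\in\Omega_{\mathbf{v}}$, with fixed unknowns $\boldsymbol{\theta}\in\boldsymbol{\Theta}\subseteq\mathbb{R}^p$. Expectations and variances are over the joint law of $(\mathbf{y},\mathbf{v})$ under $\boldsymbol{\theta}$. $\nabla_{\boldsymbol{\theta},\mathbf{v}}\boldsymbol{\zeta}$ is the matrix of first partial derivatives of $\boldsymbol{\zeta}$ with respect to $(\boldsymbol{\theta},\mathbf{v})$, oriented so that $\mathcal{Z}_{\boldsymbol{\theta}}$ has $\dim\boldsymbol{\zeta}$ rows and $p+n$ columns. Extended log-likelihood: $\ell_e(\boldsymbol{\theta},\mathbf{v};\mathbf{y})=\log f_{\boldsymbol{\theta}}(\mathbf{y},\mathbf{v})=\ell(\boldsymbol{\theta};\mathbf{y})+\ell_p(\mathbf{v};\boldsymbol{\theta},\mathbf{y})$, with $\ell(\boldsymbol{\theta};\mathbf{y})=\log f_{\boldsymbol{\theta}}(\mathbf{y})$ and $\ell_p(\mathbf{v};\boldsymbol{\theta},\mathbf{y})=\log f_{\boldsymbol{\theta}}(\mathbf{v}|\mathbf{y})$. h-likelihood: $h(\boldsymbol{\theta},\mathbf{v})=\ell_e(\boldsymbol{\theta},\mathbf{v};\mathbf{y})+a(\boldsymbol{\theta};\mathbf{y})$,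 where the modification term $a(\boldsymbol{\theta};\mathbf{y})$ is such that maximization of $h$ yields the maximum likelihood estimators of all fixed parameters (e.g. $a(\boldsymbol{\theta};\mathbf{y})=-\ell_p(\widetilde{\mathbf{v}};\boldsymbol{\theta},\mathbf{y})$ with $\widetilde{\mathbf{v}}=\arg\max_{\mathbf{v}}\ell_p(\mathbf{v};\boldsymbol{\theta},\mathbf{y})$, giving $h(\boldsymbol{\theta},\widetilde{\mathbf{v}})=\ell(\boldsymbol{\theta};\mathbf{y})$). By definition an h-likelihood is Bartlizable: with $S=\nabla_{\boldsymbol{\theta},\mathbf{v}}h$ and $I=-\nabla^2_{\boldsymbol{\theta},\mathbf{v}}h$, $\mathrm{E}[S(\boldsymbol{\theta},\mathbf{v})]=0$ and $\mathrm{E}[S(\boldsymbol{\theta},\mathbf{v})S(\boldsymbol{\theta},\mathbf{v})^{\intercal}-I(\boldsymbol{\theta},\mathbf{v})]=0$. Regularity conditions, for $h(\boldsymbol{\theta},\mathbf{v};\mathbf{y})$ and all the densities $f_{\boldsymbol{\theta}}(\mathbf{y})$, $f_{\boldsymbol{\theta}}(\mathbf{v})$, $f_{\boldsymbol{\theta}}(\mathbf{y}|\mathbf{v})$, $f_{\boldsymbol{\theta}}(\mathbf{v}|\mathbf{y})$: (R1) there exists an open set $\boldsymbol{\Theta}^{\ast}\subseteq\boldsymbol{\Theta}$ of which the true value is an interior point; (R2) supports are invariant to $\boldsymbol{\theta}$; (R3) continuously differentiable up to third order; (R4) integration and differentiation can be interchanged up to second order; (R5) the third derivatives are bounded by some integrable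 functions; (R6) the information matrices are positive definite.
   Formalization: The bound can fail when a(θ;y) depends on θ. Added to (R4): ∇E[T] = E[∇T + T∇h], and the same with log f in place of h, for T = ζ̂ − ζ; i.e. E[T ∇_θ a(θ;y)] = 0. The condition on h follows from that on log f when a is free of θ. *)

(* Defs.v *)
From HB Require Import structures.
From mathcomp Require Import all_boot all_order all_algebra.
From mathcomp Require Import all_classical all_reals all_analysis.

Set Implicit Arguments.
Unset Strict Implicit.
Unset Printing Implicit Defensive.

Import Order.TTheory GRing.Theory Num.Theory.
Import numFieldNormedType.Exports.

Local Open Scope classical_set_scope.
Local Open Scope ring_scope.

(* Lebesgue measure on R^n, carried by n-tuples (which have the product
   sigma-algebra): the image of lebesgue_measure \x (Lebesgue measure on R^n)
   under (x, t) |-> x :: t is Lebesgue measure on R^(n+1). *)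

Section LebesgueStep.
Context {R : realType} (n : nat).
Local Notation TR := (measurableTypeR R).
Variable m : {sigma_finite_measure set (n.-tuple TR) -> \bar R}.

Definition tcons (z : TR * n.-tuple TR) : n.+1.-tuple TR :=
  [tuple of z.1 :: z.2].

Lemma measurable_tcons : measurable_fun setT tcons.
Proof. exact: measurable_cons. Qed.

Definition lebesgue_step : set (n.+1.-tuple TR) -> \bar R :=
  pushforward (@lebesgue_measure R \x m)%E tcons.

Let lebesgue_step0 : lebesgue_step set0 = 0%E.
Proof. by rewrite /lebesgue_step /pushforward preimage_set0 measure0. Qed.

Let lebesgue_step_ge0 A : (0 <= lebesgue_step A)%E.
Proof. by rewrite /lebesgue_step /pushforward; exact: measure_ge0. Qed.

Let lebesgue_step_sigma_additive : semi_sigma_additive lebesgue_step.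
Proof.
have mT A : measurable A -> measurable (tcons @^-1` A).
  by move=> mA; rewrite -[X in measurable X]setTI; exact: measurable_tcons.
move=> F mF tF mUF; rewrite /lebesgue_step /pushforward preimage_bigcup.
apply: measure_semi_sigma_additive.
- by move=> i; exact: mT.
- apply/trivIsetP => /= i j _ _ ij; rewrite -preimage_setI.
  by move/trivIsetP : tF => /(_ _ _ _ _ ij) ->//; rewrite preimage_set0.
- by rewrite -preimage_bigcup; exact: mT.
Qed.

HB.instance Definition _ := isMeasure.Build _ _ _ lebesgue_step
  lebesgue_step0 lebesgue_step_ge0 lebesgue_step_sigma_additive.

Let lebesgue_step_sigma_finite : sigma_finite setT lebesgue_step.
Proof.
have /sigma_finiteP[F [TF ndF Foo]] := sigma_finiteT (@lebesgue_measure R).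
have /sigma_finiteP[G [TG ndG Goo]] := sigma_finiteT m.
pose u (t : n.+1.-tuple TR) : TR * n.-tuple TR := (thead t, [tuple of behead t]).
have Kt : u \o tcons = id.
  by apply/funext => -[x t]; congr pair; apply: val_inj.
have meas_u : measurable_fun setT u.
  apply/measurable_fun_pairP; split.
    exact: measurable_tnth.
  exact: measurable_behead.
exists (fun k => u @^-1` (F k `*` G k)).
  rewrite -preimage_bigcup (_ : \bigcup_k _ = setT) ?preimage_setT//.
  rewrite -setXTT TF TG predeqE => -[x y]; split; last first.
    move=> [/= [i _ Fix] [k _ Gky]]; exists (maxn i k) => //; split.
    - by move: x Fix; exact/subsetPset/ndF/leq_maxl.
    - by move: y Gky; exact/subsetPset/ndG/leq_maxr.
  by move=> [i _ []/= ? ?]; split; exists i.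
move=> k; have [mF Fk] := Foo k; have [mG Gk] := Goo k; split.
  rewrite -[X in measurable X]setTI; apply: meas_u => //.
  exact: measurableX.
rewrite /lebesgue_step /pushforward -comp_preimage Kt preimage_id.
by rewrite product_measure1E// lte_mul_pinfty// ge0_fin_numE.
Qed.

HB.instance Definition _ := @Measure_isSigmaFinite.Build _ _ _ lebesgue_step
  lebesgue_step_sigma_finite.

End LebesgueStep.

Fixpoint lebesgue_tuple (R : realType) (n : nat) :
    {sigma_finite_measure set (n.-tuple (measurableTypeR R)) -> \bar R} :=
  match n with
  | 0 => \d_([tuple] : 0.-tuple (measurableTypeR R))
  | n'.+1 => lebesgue_step (lebesgue_tuple R n')
  end.

Definition psd (R : realType) (m : nat) (A : 'M[R]_m) : Prop :=
  A^T = A /\ forall u : 'rV[R]_m, 0 <= (u *m A *m u^T) 0 0.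

Definition posdef (R : realType) (m : nat) (A : 'M[R]_m) : Prop :=
  A^T = A /\ forall u : 'rV[R]_m, u != 0 -> 0 < (u *m A *m u^T) 0 0.

Definition e_ (R : realType) (q : nat) (j : 'I_q) : 'rV[R]_q := delta_mx 0 j.

Definition pd (R : realType) (q : nat) (j : 'I_q) (g : 'rV[R]_q -> R) :
    'rV[R]_q -> R :=
  fun x => 'D_(e_ R j) g x.

Fixpoint Ck (R : realType) (q k : nat) (U : set 'rV[R]_q) (g : 'rV[R]_q -> R) :
    Prop :=
  (forall x, U x -> {for x, continuous g}) /\
  match k with
  | 0 => True
  | k'.+1 => forall j : 'I_q,
      (forall x, U x -> derivable g x (e_ R j)) /\ Ck k' U (pd j g)
  end.

Definition is_argmax (R : realType) (X : Type) (A : set X) (F : X -> R) (x : X) :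
    Prop :=
  A x /\ forall x', A x' -> F x' <= F x.

Section Model.
Context {R : realType} {dy : measure_display} {Ty : measurableType dy}.
Context {p n : nat}.

(* Omega_y is the type Ty.  A sample point is a pair (y, t) where the tuple t
   stands for the row vector v = rv t. *)
Local Notation sample := (Ty * n.-tuple (measurableTypeR R))%type.

Definition rv (t : n.-tuple (measurableTypeR R)) : 'rV[R]_n :=
  \row_i tnth t i.

Variable mu : {sigma_finite_measure set Ty -> \bar R}.
Variable f : 'rV[R]_p -> Ty -> 'rV[R]_n -> R.
Variable P : 'rV[R]_p -> probability sample R.

Definition joint_density (Theta : set 'rV[R]_p) (Omega_v : set 'rV[R]_n) :
    Prop :=
  forall theta, Theta theta ->
  [/\ measurable_fun setT (fun z : sample => f theta z.1 (rv z.2)),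
      forall y v, 0 <= f theta y v,
      forall y v, ~ Omega_v v -> f theta y v = 0 &
      forall A : set sample, measurable A ->
        P theta A = (\int[mu \x lebesgue_tuple R n]_(z in A)
                       (f theta z.1 (rv z.2))%:E)%E].

Definition f_y (theta : 'rV[R]_p) (y : Ty) : R :=
  \int[lebesgue_tuple R n]_t f theta y (rv t).

Definition f_v (theta : 'rV[R]_p) (v : 'rV[R]_n) : R :=
  \int[mu]_y f theta y v.

Definition f_y_given_v (theta : 'rV[R]_p) (y : Ty) (v : 'rV[R]_n) : R :=
  f theta y v / f_v theta v.

Definition f_v_given_y (theta : 'rV[R]_p) (v : 'rV[R]_n) (y : Ty) : R :=
  f theta y v / f_y theta y.

(* Quantities depending on the unknowns x = (theta, v) and on the data y are
   functions of type field. *)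
Definition field : Type := 'rV[R]_(p + n) -> Ty -> R.

Definition grad (j : 'I_(p + n)) (G : field) : field :=
  fun x y => pd j (G ^~ y) x.

(* G as a random variable under P theta.  It is set to 0 off the support of
   f theta, a P theta-null set on which log f and its derivatives are
   meaningless. *)
Definition at_sample (theta : 'rV[R]_p) (G : field) : sample -> R :=
  fun z => if 0 < f theta z.1 (rv z.2)
           then G (row_mx theta (rv z.2)) z.1 else 0.

Definition inL (r : R) (theta : 'rV[R]_p) (G : field) : Prop :=
  at_sample theta G \in Lfun (P theta) r%:E.

Definition mean (theta : 'rV[R]_p) (G : field) : R :=
  fine 'E_(P theta)[at_sample theta G]%E.

Definition dens_fy : field := fun x y => f_y (lsubmx x) y.
Definition dens_fv : field := fun x _ => f_v (lsubmx x) (rsubmx x).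
Definition dens_fyv : field :=
  fun x y => f_y_given_v (lsubmx x) y (rsubmx x).
Definition dens_fvy : field :=
  fun x y => f_v_given_y (lsubmx x) (rsubmx x) y.

Definition log_fields (G : field) : field := fun x y => ln (G x y).

Definition ell_e : field := fun x y => ln (f (lsubmx x) y (rsubmx x)).

Variable a : 'rV[R]_p -> Ty -> R.

Definition hlik : field := fun x y => ell_e x y + a (lsubmx x) y.

(* I_theta = E[- nabla^2 h] *)
Definition hinfo (theta : 'rV[R]_p) : 'M[R]_(p + n) :=
  \matrix_(j, k) mean theta (fun x y => - grad j (grad k hlik) x y).

Definition info_y (theta : 'rV[R]_p) : 'M[R]_p :=
  \matrix_(j, k) mean theta
    (fun x y => - pd j (pd k (fun th => ln (f_y th y))) (lsubmx x)).

(* theta-hat is a maximum likelihood estimate iff it is the theta-part of a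
   joint maximizer of h. *)
Definition yields_mle (Theta : set 'rV[R]_p) : Prop :=
  forall y, (forall theta, Theta theta -> 0 < f_y theta y) ->
  forall th : 'rV[R]_p,
    is_argmax Theta (fun theta => ln (f_y theta y)) th <->
    exists v : 'rV[R]_n,
      is_argmax [set x : 'rV[R]_(p + n) |
                   Theta (lsubmx x) /\ 0 < f (lsubmx x) y (rsubmx x)]
                (hlik ^~ y) (row_mx th v).

Definition bartlizable (Theta' : set 'rV[R]_p) : Prop :=
  forall theta, Theta' theta ->
  (forall j, inL 2 theta (grad j hlik) /\ mean theta (grad j hlik) = 0) /\
  (forall j k,
     inL 1 theta (fun x y => - grad j (grad k hlik) x y) /\
     mean theta (fun x y => grad j hlik x y * grad k hlik x y
                            - (- grad j (grad k hlik) x y)) = 0).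

Definition h_likelihood (Theta Theta' : set 'rV[R]_p) : Prop :=
  yields_mle Theta /\ bartlizable Theta'.

Definition invariant_support (Theta : set 'rV[R]_p) (G : field) : Prop :=
  forall theta theta' v y, Theta theta -> Theta theta' ->
    0 < G (row_mx theta v) y -> 0 < G (row_mx theta' v) y.

Definition reg_support (Theta : set 'rV[R]_p) : Prop :=
  [/\ invariant_support Theta dens_fy, invariant_support Theta dens_fv,
      invariant_support Theta dens_fyv & invariant_support Theta dens_fvy].

Definition smooth_density (Theta' : set 'rV[R]_p) (G : field) : Prop :=
  forall y, Ck 3 [set x | Theta' (lsubmx x) /\ 0 < G x y] (G ^~ y).

Definition reg_smooth (Theta' : set 'rV[R]_p) : Prop :=
  [/\ smooth_density Theta' dens_fy, smooth_density Theta' dens_fv,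
      smooth_density Theta' dens_fyv, smooth_density Theta' dens_fvy &
      forall y, Ck 3 [set x | Theta' (lsubmx x) /\
                              0 < f (lsubmx x) y (rsubmx x)] (hlik ^~ y)].

(* d/dtheta and d^2/dtheta^2 pass under the integral of g theta. *)
Definition leibniz2 {d} {T : measurableType d} (m : {measure set T -> \bar R})
    (Theta' : set 'rV[R]_p) (g : 'rV[R]_p -> T -> R) : Prop :=
  forall theta, Theta' theta -> forall j : 'I_p,
  [/\ m.-integrable setT (fun t => (pd j (g ^~ t) theta)%:E),
      is_derive theta (e_ R j) (fun th => \int[m]_t g th t : R)
        (\int[m]_t pd j (g ^~ t) theta) &
      forall k : 'I_p,
        m.-integrable setT (fun t => (pd k (pd j (g ^~ t)) theta)%:E) /\
        is_derive theta (e_ R k) (fun th => \int[m]_t pd j (g ^~ t) th : R)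
          (\int[m]_t pd k (pd j (g ^~ t)) theta)].

(* Differentiation of E_theta[G] under the integral sign, with q playing the
   part of the log-density:
     nabla E_theta[G] = E_theta[nabla G + G nabla q],  nabla = nabla_(theta, v).
   For q = log f the right-hand side is the integral of nabla (G f).  For
   q = h and G = 1, or G a component of nabla h, these are the two Bartlett
   identities of h.  In the last n coordinates the left-hand side vanishes,
   since E_theta[G] does not depend on v. *)
Definition interchange (Theta' : set 'rV[R]_p) (q G : field) : Prop :=
  forall theta, Theta' theta -> forall k : 'I_(p + n),
  let dG : field := fun x y => grad k G x y + G x y * grad k q x y in
  [/\ inL 1 theta G, inL 1 theta dG &
      forall v : 'rV[R]_n,
        is_derive (row_mx theta v) (e_ R k) (fun x => mean (lsubmx x) G)
          (mean theta dG)].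

Definition interchange2 (Theta' : set 'rV[R]_p) (q : field) : Prop :=
  interchange Theta' q (fun _ _ => 1) /\
  forall j, interchange Theta' q (grad j q).

Definition reg_interchange (Theta' : set 'rV[R]_p) : Prop :=
  leibniz2 mu Theta' f_y /\
  leibniz2 (lebesgue_tuple R n) Theta' (fun th t => f_v th (rv t)) /\
  (forall v, (forall th, Theta' th -> 0 < f_v th v) ->
     leibniz2 mu Theta' (fun th y => f_y_given_v th y v)) /\
  (forall y, (forall th, Theta' th -> 0 < f_y th y) ->
     leibniz2 (lebesgue_tuple R n) Theta'
       (fun th t => f_v_given_y th (rv t) y)) /\
  interchange2 Theta' ell_e /\ interchange2 Theta' hlik.

Definition third_bounded (Theta' : set 'rV[R]_p) (q : field) : Prop :=
  forall i j k : 'I_(p + n), exists M : sample -> R,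
    (forall theta, Theta' theta -> M \in Lfun (P theta) 1%:E) /\
    (forall theta z, Theta' theta ->
       `|at_sample theta (grad i (grad j (grad k q))) z| <= M z).

Definition reg_third (Theta' : set 'rV[R]_p) : Prop :=
  third_bounded Theta' hlik /\
  [/\ third_bounded Theta' (log_fields dens_fy),
      third_bounded Theta' (log_fields dens_fv),
      third_bounded Theta' (log_fields dens_fyv) &
      third_bounded Theta' (log_fields dens_fvy)].

Definition reg_info (Theta' : set 'rV[R]_p) : Prop :=
  forall theta, Theta' theta -> posdef (hinfo theta) /\ posdef (info_y theta).

Context {m : nat}.
Variable zeta : 'rV[R]_(p + n) -> 'rV[R]_m.
Variable zetahat : Ty -> 'rV[R]_m.

Definition err (i : 'I_m) : field := fun x y => zetahat y 0 i - zeta x 0 i.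

Definition unbiased (Theta : set 'rV[R]_p) : Prop :=
  forall theta, Theta theta -> forall i,
    'E_(P theta)[at_sample theta (err i)]%E = 0%E.

Definition Var_err (theta : 'rV[R]_p) : 'M[R]_m :=
  \matrix_(i, j) fine (covariance (P theta) (at_sample theta (err i))
                                            (at_sample theta (err j))).

Definition dzeta (i : 'I_m) (j : 'I_(p + n)) : field :=
  fun x _ => pd j (fun x' => zeta x' 0 i) x.

(* Z_theta = E[nabla zeta], with dim zeta rows and p + n columns *)
Definition Zmat (theta : 'rV[R]_p) : 'M[R]_(m, p + n) :=
  \matrix_(i, j) mean theta (dzeta i j).

(* The expectations in Var_err and Zmat exist. *)
Definition moments_exist (Theta' : set 'rV[R]_p) : Prop :=
  forall theta, Theta' theta -> forall i,
    inL 2 theta (err i) /\ forall j, inL 1 theta (dzeta i j).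

Definition zeta_derivable (Theta' : set 'rV[R]_p) : Prop :=
  forall theta y v, Theta' theta -> 0 < f theta y v ->
  forall i j, derivable (fun x => zeta x 0 i) (row_mx theta v) (e_ R j).

(* First-order interchange for E[zetahat - zeta], both for the joint density
   and for h.  As h - log f = a(theta; y), the two together say that
   zetahat(y) - zeta is uncorrelated with nabla_theta a(theta; y), which is
   automatic when a does not depend on theta. *)
Definition reg_interchange_err (Theta' : set 'rV[R]_p) : Prop :=
  forall i, interchange Theta' ell_e (err i) /\ interchange Theta' hlik (err i).

End Model.

(* Main.v *)
(* The error zetahat - zeta and the score S = nabla h have the joint
   second-moment matrix [[Var, Z], [Z^T, I]]: differentiating
   E[zetahat - zeta] = 0 gives the block Z, and E[S S^T] = I is the second
   Bartlett identity.  A Gram matrix is positive semi-definite, hence so is the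
   Schur complement Var - Z I^-1 Z^T. *)
Require Import Defs.
From HB Require Import structures.
From mathcomp Require Import all_boot all_order all_algebra.
From mathcomp Require Import all_classical all_reals all_analysis.

Set Implicit Arguments.
Unset Strict Implicit.
Unset Printing Implicit Defensive.

Import Order.TTheory GRing.Theory Num.Theory.
Import numFieldNormedType.Exports.

Local Open Scope classical_set_scope.
Local Open Scope ring_scope.

(** A row vector in the left kernel of [A] has zero quadratic form, so positive definiteness forces
    it to vanish. *)
Lemma posdef_unitmx (R : realType) (m : nat) (A : 'M[R]_m) :
  posdef A -> A \in unitmx.
Proof.
move=> [_ Apos]; rewrite -row_free_unit -kermx_eq0.
apply/rowV0P => u /sub_kermxP uA0; apply/eqP/negPn/negP => /Apos.
by rewrite uA0 mul0mx mxE ltxx.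
Qed.

(** The Schur complement at [u] is the minimum over [w] of the quadratic form of the block matrix at
    [row_mx u w]. *)
Lemma psd_schur (R : realType) (m q : nat) (A : 'M[R]_m) (B : 'M[R]_(m, q))
    (D : 'M[R]_q) :
  posdef D -> psd (block_mx A B B^T D) -> psd (A - B *m invmx D *m B^T).
Proof.
move=> Dpos [/[!tr_block_mx]/eq_block_mx[At _ _ Dt] Mpos].
have Du := posdef_unitmx Dpos.
split=> [|u].
  by rewrite linearB/= At !trmx_mul trmxK trmx_inv Dt mulmxA.
(* The second component is the minimizing [w], the solution of [u *m B + w *m D = 0]. *)
have := Mpos (row_mx u (- (u *m B *m invmx D))).
congr (_ <= fun_of_matrix _ _ _).
(* By this choice the right half of the product with the block matrix is zero; only the half paired
   with [u^T] survives. *)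
rewrite mul_row_block tr_row_mx mul_row_col !mulNmx mulmxKV// subrr mul0mx addr0.
by rewrite mulmxBl mulmxBr mulmxBl !mulmxA.
Qed.

Section gram.
Context d (T : measurableType d) (R : realType) (P : probability T R).

Lemma Lfun1_sum (I : finType) (X : I -> T -> R) :
  (forall i, X i \in Lfun P 1%:E) ->
  (fun t => \sum_i X i t) \in Lfun P 1%:E.
Proof.
move=> X1; apply/Lfun1_integrable.
rewrite (_ : _ \o _ = (fun t => \sum_i (EFin \o X i) t)%E); last first.
  by apply/funext => t /=; rewrite sumEFin.
by apply: integrable_sum => // i _; exact/Lfun1_integrable.
Qed.

(** Integrability keeps every term finite, so that [fine] commutes with the sum. *)
Lemma fine_expectation_sum (I : finType) (X : I -> T -> R) :
  (forall i, X i \in Lfun P 1%:E) ->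
  fine 'E_P[(fun t => \sum_i X i t)%R]%E = \sum_i fine 'E_P[X i]%E.
Proof.
move=> X1; rewrite unlock; under eq_integral do rewrite -sumEFin.
rewrite integral_sum => [|//|i]; last exact/Lfun1_integrable.
rewrite sum_fine// => i _.
by apply: integrable_fin_num => //; exact/Lfun1_integrable.
Qed.

(** The quadratic form at [u] is the expectation of the square of the combination of the [W i] with
    coefficients [u 0 i]. *)
Lemma psd_gram (q : nat) (W : 'I_q -> T -> R) :
  (forall i, W i \in Lfun P 2%:E) ->
  psd (\matrix_(i, j) fine 'E_P[(W i \* W j)%R]%E).
Proof.
move=> W2.
have W1 i j : W i \* W j \in Lfun P 1%:E by exact: Lfun2_mul_Lfun1.
split=> [|u].
  apply/matrixP => i j; rewrite !mxE; congr (fine (expectation _ _)).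
  by apply/funext => t /=; rewrite mulrC.
have uW1 i j : (u 0 i * u 0 j) \o* (W i \* W j) \in Lfun P 1%:E.
  exact: Lfun_scale.
suff -> : (u *m (\matrix_(i, j) fine 'E_P[(W i \* W j)%R]%E) *m u^T) 0 0 =
    fine 'E_P[(fun t => (\sum_i u 0 i * W i t) ^+ 2)%R]%E.
  by rewrite fine_ge0// expectation_ge0// => t; rewrite sqr_ge0.
(* The square is expanded with [j] outside and [i] inside, the order in which the sums of
   [u *m _ *m u^T] unfold. *)
rewrite (_ : (fun t => _) =
    fun t => \sum_j \sum_i ((u 0 i * u 0 j) \o* (W i \* W j)) t); last first.
  apply/funext => t; rewrite expr2 big_distrr/=; apply: eq_bigr => j _.
  rewrite big_distrl/=; apply: eq_bigr => i _.
  by rewrite [RHS]mulrC mulrACA.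
rewrite fine_expectation_sum => [|j]; last exact: Lfun1_sum.
rewrite mxE; apply: eq_bigr => j _.
rewrite fine_expectation_sum// !mxE big_distrl; apply: eq_bigr => i _ /=.
rewrite expectationZl; last exact: W1.
rewrite fineM ?expectation_fin_num//; last exact: W1.
by rewrite mxE mulrAC.
Qed.

End gram.

(** Balls are taken entrywise, so the same radius works for the left block. This carries a property
    holding near theta to points near (theta, v), where derivatives are taken. *)
Lemma near_lsubmx (R : realType) (p n : nat) (U : set 'rV[R]_p) (th : 'rV[R]_p)
    (v : 'rV[R]_n) :
  nbhs th U -> \forall x \near row_mx th v, U (lsubmx x).
Proof.
move=> /nbhs_ballP[e e0 eU]; apply/nbhs_ballP; exists e => // x [_ bx].
apply: eU; split=> // i j; have := bx i (lshift n j).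
by rewrite row_mxEl !mxE.
Qed.

Section model.
Context {R : realType} {dy : measure_display} {Ty : measurableType dy}.
Context {p n : nat}.
Variable f : 'rV[R]_p -> Ty -> 'rV[R]_n -> R.

Lemma at_sampleM (theta : 'rV[R]_p) (G H : @field R dy Ty p n) :
  at_sample f theta (fun x y => G x y * H x y) =
  at_sample f theta G \* at_sample f theta H.
Proof. by apply/funext => z; rewrite /at_sample/=; case: ifP; rewrite ?mulr0. Qed.

Lemma at_sampleB (theta : 'rV[R]_p) (G H : @field R dy Ty p n) :
  at_sample f theta (fun x y => G x y - H x y) =
  at_sample f theta G \- at_sample f theta H.
Proof. by apply/funext => z; rewrite /at_sample/=; case: ifP; rewrite ?subr0. Qed.

Variable P : 'rV[R]_p -> probability (Ty * n.-tuple (measurableTypeR R))%type R.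

Lemma meanB (theta : 'rV[R]_p) (G H : @field R dy Ty p n) :
  inL f P 1 theta G -> inL f P 1 theta H ->
  mean f P theta (fun x y => G x y - H x y) = mean f P theta G - mean f P theta H.
Proof.
move=> G1 H1; rewrite /mean at_sampleB expectationB//.
by rewrite fineB ?expectation_fin_num.
Qed.

Context {m : nat}.
Variables (zeta : 'rV[R]_(p + n) -> 'rV[R]_m) (zetahat : Ty -> 'rV[R]_m).
Variables (a : 'rV[R]_p -> Ty -> R).
Variables (Theta Theta' : set 'rV[R]_p) (theta : 'rV[R]_p).
Hypothesis Theta'_open : open Theta'.
Hypothesis Theta'_sub : Theta' `<=` Theta.
Hypothesis Theta'_theta : Theta' theta.

(** On the support [zetahat y] is constant in the unknowns and [zeta] is derivable; off it both
    sides take the default value 0. *)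
Lemma at_sample_grad_err (i : 'I_m) (k : 'I_(p + n)) :
  zeta_derivable f zeta Theta' ->
  at_sample f theta (grad k (err zeta zetahat i)) =
  \- at_sample f theta (dzeta zeta i k).
Proof.
move=> dz; apply/funext => -[y t]; rewrite /at_sample/=.
case: ifPn => [f0|_]; last by rewrite oppr0.
rewrite /grad /dzeta /pd /err.
rewrite (@deriveB _ _ _ (cst (zetahat y 0 i))) ?derive_cst ?sub0r//.
exact: dz f0 _ _.
Qed.

(* E[zetahat - zeta] vanishes on a neighbourhood of theta, hence so does its
   derivative E[- nabla zeta + (zetahat - zeta) S]. *)
Lemma mean_err_score (i : 'I_m) (k : 'I_(p + n)) :
  zeta_derivable f zeta Theta' ->
  unbiased f P zeta zetahat Theta ->
  Defs.interchange f P Theta' (hlik f a) (err zeta zetahat i) ->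
  inL f P 2 theta (err zeta zetahat i) ->
  inL f P 2 theta (grad k (hlik f a)) ->
  inL f P 1 theta (dzeta zeta i k) ->
  mean f P theta (fun x y => err zeta zetahat i x y * grad k (hlik f a) x y)
  = mean f P theta (dzeta zeta i k).
Proof.
(* The mean depends on theta alone, so any base point serves for v; 0 is chosen. *)
move=> dz unb /(_ _ Theta'_theta k)[_ _ /(_ 0) der] E2 S2 Z1.
have : mean f P theta (fun x y => err zeta zetahat i x y * grad k (hlik f a) x y
    - dzeta zeta i k x y) = 0.
  (* The integrand is put in the form of [dG] in [interchange]; the two fields are compared only
     through [at_sample], that is, on the support. *)
  rewrite (_ : mean _ _ _ _ = mean f P theta (fun x y =>
      grad k (err zeta zetahat i) x y +
      err zeta zetahat i x y * grad k (hlik f a) x y)); last first.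
    congr (fine (expectation _ _)); apply/funext => z.
    have := congr1 (@^~ z) (at_sample_grad_err i k dz).
    by rewrite /at_sample/=; case: (0 < _) => // ->; rewrite addrC.
  case: der => _ <-.
  rewrite (@near_eq_derive _ _ _ _ (cst 0)) ?derive_cst//.
  near=> x.
  rewrite /mean (unb (lsubmx x))//.
  by apply: Theta'_sub; near: x; apply: near_lsubmx; exact: open_nbhs_nbhs.
rewrite meanB// => [/eqP|]; first by rewrite subr_eq0 => /eqP.
by rewrite /inL at_sampleM; exact: Lfun2_mul_Lfun1.
Unshelve. all: by end_near. Qed.

(** This is the second Bartlett identity with its mean split in two, which is legitimate because
    square-integrable scores have integrable products. *)
Lemma hinfo_score (j k : 'I_(p + n)) :
  bartlizable f P a Theta' ->
  mean f P theta (fun x y => grad j (hlik f a) x y * grad k (hlik f a) x y)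
  = hinfo f P a theta j k.
Proof.
move=> /(_ _ Theta'_theta)[S2 /(_ j k)[I1]].
rewrite meanB// => [/eqP|]; first by rewrite subr_eq0 mxE => /eqP.
rewrite /inL at_sampleM; apply: Lfun2_mul_Lfun1.
- by case: (S2 j).
- by case: (S2 k).
Qed.

(** Unbiasedness removes the product of the means from the covariance. *)
Lemma Var_err_unbiased (i j : 'I_m) :
  unbiased f P zeta zetahat Theta ->
  inL f P 2 theta (err zeta zetahat i) -> inL f P 2 theta (err zeta zetahat j) ->
  Var_err f P zeta zetahat theta i j =
  mean f P theta (fun x y => err zeta zetahat i x y * err zeta zetahat j x y).
Proof.
move=> unb i2 j2; have thetaT := Theta'_sub Theta'_theta.
rewrite mxE covarianceE ?Lfun2_mul_Lfun1 ?Lfun_subset12 ?fin_num_measure//.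
by rewrite !unb// mul0e sube0 /mean at_sampleM.
Qed.

End model.

Theorem theorem2 (R : realType) (dy : measure_display) (Ty : measurableType dy)
    (mu : {sigma_finite_measure set Ty -> \bar R}) (p n m : nat)
    (Theta : set 'rV[R]_p) (Omega_v : set 'rV[R]_n)
    (f : 'rV[R]_p -> Ty -> 'rV[R]_n -> R)
    (P : 'rV[R]_p -> probability (Ty * n.-tuple (measurableTypeR R))%type R)
    (a : 'rV[R]_p -> Ty -> R)
    (zeta : 'rV[R]_(p + n) -> 'rV[R]_m) (zetahat : Ty -> 'rV[R]_m)
    (Theta' : set 'rV[R]_p) (theta0 : 'rV[R]_p)
    (model : joint_density mu f P Theta Omega_v)
    (hlikelihood : h_likelihood f P a Theta Theta')
    (R1 : [/\ open Theta', Theta' `<=` Theta & interior Theta' theta0])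
    (R2 : reg_support mu f Theta)
    (R3 : reg_smooth mu f a Theta')
    (R4 : reg_interchange mu f P a Theta')
    (R4_err : reg_interchange_err f P a zeta zetahat Theta')
    (R5 : reg_third mu f P a Theta')
    (R6 : reg_info f P a Theta')
    (zetahat_measurable : forall i, measurable_fun setT (fun y => zetahat y 0 i))
    (zeta_partials : zeta_derivable f zeta Theta')
    (moments : moments_exist f P zeta zetahat Theta')
    (zetahat_unbiased : unbiased f P zeta zetahat Theta) :
  psd (Var_err f P zeta zetahat theta0
       - Zmat f P zeta theta0 *m invmx (hinfo f P a theta0)
           *m (Zmat f P zeta theta0)^T).
Proof.
case: R1 => Theta'_open Theta'_sub /interior_subset Theta'_theta0.
case: hlikelihood => _ bartlett; have [S2 _] := bartlett _ Theta'_theta0.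
have [I_pos _] := R6 _ Theta'_theta0.
have moments0 := moments _ Theta'_theta0.
apply: psd_schur => //.
(* The [m] errors come first, then the [p + n] scores, following the rows of the block matrix. *)
pose W (l : 'I_(m + (p + n))) := match fintype.split l with
  | inl i => at_sample f theta0 (err zeta zetahat i)
  | inr k => at_sample f theta0 (grad k (hlik f a))
  end.
have W2 l : W l \in Lfun (P theta0) 2%:E.
  rewrite /W; case: fintype.split => [i|k]; first exact: (moments0 i).1.
  exact: (S2 k).1.
suff -> : block_mx (Var_err f P zeta zetahat theta0) (Zmat f P zeta theta0)
    (Zmat f P zeta theta0)^T (hinfo f P a theta0) =
    \matrix_(l, l') fine 'E_(P theta0)[(W l \* W l')%R]%E by exact: psd_gram.
have Zscore i k : mean f P theta0
    (fun x y => err zeta zetahat i x y * grad k (hlik f a) x y) =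
    Zmat f P zeta theta0 i k.
  rewrite [RHS]mxE.
  apply: (mean_err_score (Theta := Theta) (Theta' := Theta')) => //.
  (* The second half is the interchange with [hlik] in place of the log-density, which brings in the
     score of h. *)
  - exact: (R4_err i).2.
  - exact: (moments0 i).1.
  - exact: (S2 k).1.
  - exact: (moments0 i).2.
apply/matrixP => l l'; rewrite [RHS]mxE -(fintype.splitK l) -(fintype.splitK l').
case: (fintype.split l) => [i|k]; case: (fintype.split l') => [j|k'];
  rewrite /W !unsplitK /=
    ?block_mxEul ?block_mxEur ?block_mxEdl ?block_mxEdr.
- have [E2i _] := moments0 i; have [E2j _] := moments0 j.
  rewrite (Var_err_unbiased Theta'_sub Theta'_theta0 zetahat_unbiased E2i E2j).
  by rewrite /mean at_sampleM.
- by rewrite -Zscore /mean at_sampleM.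
(* In the transposed block the score is the left factor, so the product has to be commuted. *)
- rewrite mxE -Zscore /mean at_sampleM; congr (fine (expectation _ _)).
  by apply/funext => z /=; rewrite mulrC.
- by rewrite -(hinfo_score Theta'_theta0 _ _ bartlett) /mean at_sampleM.
Qed.
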